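(* Let $\varphi\in C^2(\overline{H^2})\cap C^\infty(H^2)$ satisfy $\varphi\ge0$ on $\overline{H^2}$, $\varphi(0,y)=0$ for all $y\in\mathbb{R}$, and $$\varphi_{xx}+\varphi_{yy}-\frac1x\varphi_x=0\quad\text{on }H^2.$$ Then there is a constant $A\ge 0$ with $\varphi(x,y)=A\,x^2$ for all $(x,y)\in\overline{H^2}$.
   Context: $H^2=\{(x,y)\in\mathbb{R}^2: x>0\}$ is the open right half-plane and $\overline{H^2}=\{x\ge0\}$ its closure. *)

(* Defs.v *)
From Stdlib Require Import Reals Lra.
Open Scope R_scope.

Definition H2 (x y : R) : Prop := 0 < x.
Definition H2bar (x y : R) : Prop := 0 <= x.

Definition cont_on (S : R -> R -> Prop) (g : R -> R -> R) : Prop :=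
  forall x0 y0, S x0 y0 ->
    forall eps, 0 < eps -> exists delta, 0 < delta /\
      forall x y, S x y -> Rabs (x - x0) < delta -> Rabs (y - y0) < delta ->
        Rabs (g x y - g x0 y0) < eps.

(* Ck k D S f : the partial derivatives of f of order <= k exist on the open
   set D, and f together with all these partial derivatives are continuous on S
   (more precisely, extend continuously to S, where D is a subset of S).
   With S = D this is C^k(D); with D = H2, S = H2bar it is C^k(closure of H^2). *)
Fixpoint Ck (k : nat) (D S : R -> R -> Prop) (f : R -> R -> R) : Prop :=
  match k with
  | O => cont_on S f
  | Datatypes.S n =>
      cont_on S f /\
      exists fx fy : R -> R -> R,
        (forall x y, D x y -> derivable_pt_lim (fun t => f t y) x (fx x y)) /\
        (forall x y, D x y -> derivable_pt_lim (fun t => f x t) y (fy x y)) /\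
        Ck n D S fx /\ Ck n D S fy
  end.

Definition Cinf (D : R -> R -> Prop) (f : R -> R -> R) : Prop :=
  forall k, Ck k D D f.

(* Main.v *)
(* In polar coordinates x = r sqrt(1 - s^2), y = r s the equation becomes
   r^2 f_rr + (1 - s^2) f_ss = 0. Integrating by parts, the moments
   I_k(r) = int_{-1}^1 s^k f(r, s) ds satisfy
     r^2 I_k'' = (k+1)(k+2) I_k - k(k-1) I_(k-2).
   If I_(k-2) vanishes this is an Euler equation, and since I_k is bounded at 0
   it is a multiple of r^(k+2). In particular I_0 = a r^2, and positivity gives
   |I_k| <= I_0 = a r^2. Subtracting from f the multiple A x^2 that makes I_0
   vanish keeps every moment O(r^2), so r^(k+2) is excluded for k >= 1 and by
   induction all moments are 0. A continuous function on [-1, 1] with vanishing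
   moments is 0. *)
Require Import Defs.
From Stdlib Require Import Reals Lra Lia Wf_nat.
From Coquelicot Require Import Coquelicot.
Open Scope R_scope.

(** * Functions of class C^1 up to the boundary line *)

(** On the line x = 0 the functions [gx] and [gy] are only continuous extensions of the partials, so
    every fact about them there has to be obtained as a limit from the interior. *)
Record has_partials (g gx gy : R -> R -> R) : Prop := {
  partials_cont : cont_on H2bar g;
  partials_cont_x : cont_on H2bar gx;
  partials_cont_y : cont_on H2bar gy;
  partials_x : forall x y, 0 < x -> is_derive (fun t => g t y) x (gx x y);
  partials_y : forall x y, 0 < x -> is_derive (fun t => g x t) y (gy x y) }.

Lemma cont_on_minus (D : R -> R -> Prop) (g h : R -> R -> R) :
  cont_on D g -> cont_on D h -> cont_on D (fun x y => g x y - h x y).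
Proof.
intros Hg Hh x0 y0 H0 eps Heps.
destruct (Hg x0 y0 H0 (eps / 2)) as [d1 [Hd1 H1]]; [lra|].
destruct (Hh x0 y0 H0 (eps / 2)) as [d2 [Hd2 H2']]; [lra|].
exists (Rmin d1 d2); split; [now apply Rmin_pos|].
intros x y HD Hx Hy.
pose proof (Rmin_l d1 d2); pose proof (Rmin_r d1 d2).
specialize (H1 x y HD ltac:(lra) ltac:(lra)).
specialize (H2' x y HD ltac:(lra) ltac:(lra)).
apply Rabs_def2 in H1; apply Rabs_def2 in H2'; apply Rabs_def1; lra.
Qed.

Lemma has_partials_minus (g gx gy h hx hy : R -> R -> R) :
  has_partials g gx gy -> has_partials h hx hy ->
  has_partials (fun x y => g x y - h x y) (fun x y => gx x y - hx x y)
    (fun x y => gy x y - hy x y).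
Proof.
intros [g0 g1 g2 g3 g4] [h0 h1 h2 h3 h4].
split; try (now apply cont_on_minus); intros x y Hx.
- apply @is_derive_minus; auto.
- apply @is_derive_minus; auto.
Qed.

Lemma cont_on_of_continuity_2d (D : R -> R -> Prop) (g : R -> R -> R) :
  (forall x y, continuity_2d_pt g x y) -> cont_on D g.
Proof.
intros H x0 y0 _ eps Heps.
destruct (H x0 y0 (mkposreal eps Heps)) as [d Hd].
exists d; split; [apply cond_pos|]; intros x y _; apply Hd.
Qed.

Lemma has_partials_const (c : R) :
  has_partials (fun _ _ => c) (fun _ _ => 0) (fun _ _ => 0).
Proof.
split; try (apply cont_on_of_continuity_2d; intros; apply continuity_2d_pt_const);
  intros x y Hx; apply @is_derive_const.
Qed.

Lemma has_partials_linear (c : R) :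
  has_partials (fun x _ => c * x) (fun _ _ => c) (fun _ _ => 0).
Proof.
split; try (apply cont_on_of_continuity_2d; intros).
- apply continuity_2d_pt_mult; [apply continuity_2d_pt_const|apply continuity_2d_pt_id1].
- apply continuity_2d_pt_const.
- apply continuity_2d_pt_const.
- intros x y _; auto_derive; trivial; ring.
- intros x y _; apply @is_derive_const.
Qed.

Lemma has_partials_sq (c : R) :
  has_partials (fun x _ => c * x ^ 2) (fun x _ => 2 * c * x) (fun _ _ => 0).
Proof.
split; try (apply cont_on_of_continuity_2d; intros).
- apply continuity_2d_pt_mult; [apply continuity_2d_pt_const|].
  apply (continuity_2d_pt_ext (fun u v => u * u)); [intros; ring|].
  apply continuity_2d_pt_mult; apply continuity_2d_pt_id1.
- apply continuity_2d_pt_mult; [apply continuity_2d_pt_const|apply continuity_2d_pt_id1].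
- apply continuity_2d_pt_const.
- intros x y _; auto_derive; trivial; ring.
- intros x y _; apply @is_derive_const.
Qed.

(** If [gy 0 y0] were some l <> 0, then |gy| > |l|/2 near (0, y0), and the mean value theorem on a
    short vertical segment close to the boundary would give [g] a definite increment. Continuity of
    [g] makes that increment arbitrarily small as the segment approaches the boundary. *)
Lemma tangential_partial_at_boundary (g gx gy : R -> R -> R) :
  has_partials g gx gy -> (forall y, g 0 y = 0) -> forall y, gy 0 y = 0.
Proof.
intros [g0 g1 g2 g3 g4] Hg y0.
destruct (Req_dec (gy 0 y0) 0) as [E|E]; [exact E|exfalso].
set (l := gy 0 y0) in *.
assert (Hl : 0 < Rabs l) by now apply Rabs_pos_lt.
destruct (g2 0 y0 (Rle_refl 0) (Rabs l / 2)) as [d [Hd H]]; [lra|].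
(* The increment over length d/2 exceeds |l| d / 4, while the two end values together stay below 2e
   = |l| d / 8. *)
set (e := Rabs l * d / 16).
assert (He : 0 < e) by (unfold e; nra).
destruct (g0 0 y0 (Rle_refl 0) e He) as [d1 [Hd1 H1]].
destruct (g0 0 (y0 + d / 2) (Rle_refl 0) e He) as [d2 [Hd2 H2']].
set (x := Rmin d (Rmin d1 d2) / 2).
assert (Hx : 0 < x /\ x < d /\ x < d1 /\ x < d2).
{ unfold x.
  pose proof (Rmin_l d (Rmin d1 d2)); pose proof (Rmin_r d (Rmin d1 d2)).
  pose proof (Rmin_l d1 d2); pose proof (Rmin_r d1 d2).
  assert (0 < Rmin d (Rmin d1 d2)) by (repeat apply Rmin_pos; lra).
  lra. }
destruct Hx as [Hx0 [Hxd [Hx1 Hx2]]].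
assert (Ax : Rabs (x - 0) = x) by (rewrite Rminus_0_r, Rabs_pos_eq; lra).
assert (Z : forall z, Rabs (z - z) = 0) by (intros z; rewrite Rminus_diag; apply Rabs_R0).
specialize (H1 x y0). rewrite Ax, Z, Hg, Rminus_0_r in H1.
specialize (H1 (Rlt_le _ _ Hx0) Hx1 Hd1).
specialize (H2' x (y0 + d / 2)). rewrite Ax, Z, Hg, Rminus_0_r in H2'.
specialize (H2' (Rlt_le _ _ Hx0) Hx2 Hd2).
destruct (MVT_gen (fun t => g x t) y0 (y0 + d / 2) (fun t => gy x t)) as [c [Hc Hm]].
- intros; now apply g4.
- intros z _; apply continuity_pt_filterlim, (ex_derive_continuous (fun t => g x t)).
  eexists; now apply g4.
- rewrite Rmin_left, Rmax_right in Hc by lra.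
  specialize (H x c); rewrite Ax in H.
  specialize (H (Rlt_le _ _ Hx0) Hxd).
  assert (Rabs (c - y0) < d) by (apply Rabs_def1; lra).
  specialize (H H0). fold l in H.
  assert (K : Rabs l / 2 < Rabs (gy x c)).
  { pose proof (Rabs_triang (l - gy x c) (gy x c)) as T.
    replace (l - gy x c + gy x c) with l in T by ring.
    rewrite (Rabs_minus_sym l) in T. lra. }
  assert (K2 : Rabs (g x (y0 + d / 2) - g x y0) = Rabs (gy x c) * (d / 2)).
  { rewrite Hm, Rabs_mult. f_equal. rewrite Rabs_pos_eq; lra. }
  pose proof (Rabs_triang (g x (y0 + d / 2)) (- g x y0)) as T.
  rewrite Rabs_Ropp in T. unfold Rminus in K2. unfold e in *. nra.
Qed.

Lemma is_derive_along_curve (g gx gy : R -> R -> R) (X Y : R -> R) (t dX dY : R) :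
  has_partials g gx gy -> 0 < X t -> is_derive X t dX -> is_derive Y t dY ->
  is_derive (fun u => g (X u) (Y u)) t (gx (X t) (Y t) * dX + gy (X t) (Y t) * dY).
Proof.
intros [g0 g1 g2 g3 g4] Ht HX HY.
apply is_derive_Reals, derivable_pt_lim_comp_2d; try now apply is_derive_Reals.
apply filterdiff_differentiable_pt_lim.
(* Total differentiability follows from [gx] existing nearby and being continuous at the point,
   together with [gy] existing at the point. *)
apply (is_derive_filterdiff g (X t) (Y t) gx (gy (X t) (Y t))).
- exists (mkposreal _ Ht); intros [u v] [Hu _].
  apply g3; apply Rabs_def2 in Hu; simpl in *; unfold minus, plus, opp in Hu; simpl in Hu; lra.
- now apply g4.
- apply continuity_2d_pt_filterlim.
  intros eps.
  destruct (g1 (X t) (Y t) (Rlt_le _ _ Ht) eps (cond_pos eps)) as [d [Hd H]].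
  exists (mkposreal (Rmin d (X t)) (Rmin_pos _ _ Hd Ht)); simpl; intros u v Hu Hv.
  pose proof (Rmin_l d (X t)); pose proof (Rmin_r d (X t)).
  apply H; [|lra|lra]. apply Rabs_def2 in Hu. unfold H2bar; lra.
Qed.

(** * Polar coordinates *)

(* [s] is the cosine of the polar angle measured from the boundary line, [cs s]
   its sine; since Rocq's [sqrt] vanishes on negative numbers, [cs] is defined
   and continuous on the whole line and is [0] outside (-1, 1). *)
Definition cs (s : R) : R := sqrt (1 - s ^ 2).

Definition polar (g : R -> R -> R) (r s : R) : R := g (r * cs s) (r * s).

Lemma cs_pos (s : R) : 0 <= cs s.
Proof. apply sqrt_pos. Qed.

Lemma cs_sq (s : R) : -1 <= s <= 1 -> cs s * cs s = 1 - s ^ 2.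
Proof. intros H; apply sqrt_sqrt; nra. Qed.

Lemma cs_interior (s : R) : -1 < s < 1 -> 0 < cs s.
Proof. intros H; apply sqrt_lt_R0; nra. Qed.

Lemma continuity_cs (s : R) : continuity_pt cs s.
Proof.
apply continuity_pt_filterlim.
apply (continuous_comp (fun s => 1 - s ^ 2) sqrt); [|apply continuous_sqrt].
apply @ex_derive_continuous; auto_derive; trivial.
Qed.

Lemma is_derive_cs (s : R) : -1 < s < 1 -> is_derive cs s (- s / cs s).
Proof.
intros H; unfold cs; auto_derive; [nra|].
assert (0 < sqrt (1 - s ^ 2)) by now apply cs_interior.
replace (1 + - (s * (s * 1))) with (1 - s ^ 2) by ring.
field; lra.
Qed.

Lemma continuity_2d_polar (g : R -> R -> R) (r s : R) :
  cont_on H2bar g -> 0 < r -> continuity_2d_pt (polar g) r s.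
Proof.
intros Hg Hr eps.
assert (Hb : H2bar (r * cs s) (r * s)) by (unfold H2bar; pose proof (cs_pos s); nra).
destruct (Hg _ _ Hb eps (cond_pos eps)) as [d [Hd H]].
assert (C1 : continuity_2d_pt (fun u v => u * cs v) r s).
{ apply continuity_2d_pt_mult; [apply continuity_2d_pt_id1|].
  apply (continuity_1d_2d_pt_comp cs (fun _ v => v)); [apply continuity_cs|].
  apply continuity_2d_pt_id2. }
assert (C2 : continuity_2d_pt (fun u v => u * v) r s).
{ apply continuity_2d_pt_mult; [apply continuity_2d_pt_id1|apply continuity_2d_pt_id2]. }
destruct (C1 (mkposreal d Hd)) as [d1 H1]; destruct (C2 (mkposreal d Hd)) as [d2 H2'].
simpl in H1, H2'.
(* Including [r] in the minimum keeps [u] positive, so the perturbed point stays in the closed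
   half-plane. *)
assert (P : 0 < Rmin r (Rmin d1 d2)) by (repeat apply Rmin_pos; try apply cond_pos; lra).
exists (mkposreal _ P); simpl; intros u v Hu Hv.
pose proof (Rmin_l r (Rmin d1 d2)); pose proof (Rmin_r r (Rmin d1 d2)).
pose proof (Rmin_l d1 d2); pose proof (Rmin_r d1 d2).
unfold polar; apply H.
- unfold H2bar. pose proof (cs_pos v).
  assert (Rabs (u - r) < r) by lra. apply Rabs_def2 in H6. nra.
- apply H1; lra.
- apply H2'; lra.
Qed.

Lemma continuity_2d_pt_snd (g : R -> R) (r s : R) :
  continuity_pt g s -> continuity_2d_pt (fun _ v => g v) r s.
Proof.
intros H; apply (continuity_1d_2d_pt_comp g (fun _ v => v)); [exact H|].
apply continuity_2d_pt_id2.
Qed.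

Lemma continuity_pt_section (g : R -> R -> R) (r s : R) :
  continuity_2d_pt g r s -> continuity_pt (g r) s.
Proof.
intros H; apply continuity_pt_locally; intros eps.
apply (locally_2d_1d_const_x _ _ _ (H eps)).
Qed.

(** The derivative along the ray: the gradient paired with the unit vector (cs s, s). *)
Definition radial (gx gy : R -> R -> R) (r s : R) : R :=
  cs s * polar gx r s + s * polar gy r s.

Lemma continuity_2d_radial (gx gy : R -> R -> R) (r s : R) :
  cont_on H2bar gx -> cont_on H2bar gy -> 0 < r ->
  continuity_2d_pt (radial gx gy) r s.
Proof.
intros Hx Hy Hr; unfold radial.
apply (continuity_2d_pt_plus (fun r s => cs s * polar gx r s) (fun r s => s * polar gy r s));
  apply continuity_2d_pt_mult; try now apply continuity_2d_polar.
- apply continuity_2d_pt_snd, continuity_cs.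
- apply continuity_2d_pt_id2.
Qed.

Lemma is_derive_polar_interior (g gx gy : R -> R -> R) (r s : R) :
  has_partials g gx gy -> 0 < cs s -> 0 < r ->
  is_derive (fun u => polar g u s) r (radial gx gy r s).
Proof.
intros Hg Hc Hr; unfold polar.
replace (radial gx gy r s) with
  (gx (r * cs s) (r * s) * cs s + gy (r * cs s) (r * s) * s)
  by (unfold radial, polar; ring).
apply (is_derive_along_curve g gx gy (fun u => u * cs s) (fun u => u * s)); trivial.
- nra.
- auto_derive; trivial; ring.
- auto_derive; trivial; ring.
Qed.

(** Where [cs s] = 0 the ray lies in the boundary, [polar g] is constantly 0 on it, and the claimed
    derivative reduces to s times the tangential partial, which vanishes there. *)
Lemma is_derive_polar (g gx gy : R -> R -> R) (r s : R) :
  has_partials g gx gy -> (forall y, g 0 y = 0) -> 0 < r ->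
  is_derive (fun u => polar g u s) r (radial gx gy r s).
Proof.
intros Hg Hb Hr.
destruct (cs_pos s) as [Hc|Hc]; [now apply is_derive_polar_interior|].
unfold polar, radial, polar; rewrite <- Hc.
rewrite Rmult_0_r, (tangential_partial_at_boundary _ _ _ Hg Hb).
apply (is_derive_ext (fun _ => 0)).
- intros t; now rewrite Rmult_0_r, Hb.
- replace (0 * gx 0 (r * s) + s * 0) with 0 by ring. apply @is_derive_const.
Qed.

Lemma is_derive_polar_angle (g gx gy : R -> R -> R) (r s : R) :
  has_partials g gx gy -> -1 < s < 1 -> 0 < r ->
  is_derive (polar g r) s (r * (polar gy r s - s / cs s * polar gx r s)).
Proof.
intros Hg Hs Hr; unfold polar.
assert (Hc := cs_interior s Hs).
replace (r * (gy (r * cs s) (r * s) - s / cs s * gx (r * cs s) (r * s))) with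
  (gx (r * cs s) (r * s) * (r * (- s / cs s)) + gy (r * cs s) (r * s) * r)
  by (field; lra).
apply (is_derive_along_curve g gx gy (fun s => r * cs s) (fun s => r * s)); trivial.
- nra.
- apply is_derive_scal, is_derive_cs, Hs.
- auto_derive; trivial; ring.
Qed.

(** * The equation and the second radial derivative *)

(** This is the equation of the Stokes stream function of an axisymmetric irrotational flow, [x]
    being the distance to the axis. *)
Record axisymmetric_solution (f fx fy fxx fxy fyx fyy : R -> R -> R) : Prop := {
  sol_partials : has_partials f fx fy;
  sol_partials_x : has_partials fx fxx fxy;
  sol_partials_y : has_partials fy fyx fyy;
  sol_boundary : forall y, f 0 y = 0;
  sol_eq : forall x y, 0 < x -> fxx x y + fyy x y - fx x y / x = 0 }.

Definition radial2 (gxx gxy gyx gyy : R -> R -> R) (r s : R) : R :=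
  cs s * radial gxx gxy r s + s * radial gyx gyy r s.

Lemma continuity_2d_radial2 (gxx gxy gyx gyy : R -> R -> R) (r s : R) :
  cont_on H2bar gxx -> cont_on H2bar gxy -> cont_on H2bar gyx -> cont_on H2bar gyy ->
  0 < r -> continuity_2d_pt (radial2 gxx gxy gyx gyy) r s.
Proof.
intros Hxx Hxy Hyx Hyy Hr; unfold radial2.
apply (continuity_2d_pt_plus (fun r s => cs s * radial gxx gxy r s)
         (fun r s => s * radial gyx gyy r s));
  apply continuity_2d_pt_mult; try now apply continuity_2d_radial.
- apply continuity_2d_pt_snd, continuity_cs.
- apply continuity_2d_pt_id2.
Qed.

(** On a boundary ray the factor [cs s] removes [fx], and [fy] vanishes on the boundary, so
    [is_derive_polar] applies to [fy] itself. *)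
Lemma is_derive_radial (f fx fy fxx fxy fyx fyy : R -> R -> R) (r s : R) :
  axisymmetric_solution f fx fy fxx fxy fyx fyy -> 0 < r ->
  is_derive (fun u => radial fx fy u s) r (radial2 fxx fxy fyx fyy r s).
Proof.
intros [Hf Hfx Hfy Hb _] Hr.
assert (Hyb := tangential_partial_at_boundary _ _ _ Hf Hb).
destruct (cs_pos s) as [Hc|Hc].
- apply (is_derive_plus (fun u => cs s * polar fx u s) (fun u => s * polar fy u s));
    apply is_derive_scal; now apply is_derive_polar_interior.
- unfold radial2; rewrite <- Hc, Rmult_0_l, Rplus_0_l.
  apply (is_derive_ext (fun u => s * polar fy u s)).
  + intros t; unfold radial; now rewrite <- Hc, Rmult_0_l, Rplus_0_l.
  + apply is_derive_scal; now apply is_derive_polar.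
Qed.

(** * Differentiation under the integral and integration by parts *)

Lemma ex_RInt_continuity (h : R -> R) (a b : R) :
  (forall s, continuity_pt h s) -> ex_RInt h a b.
Proof.
intros Hh; apply (ex_RInt_continuous (V := R_CompleteNormedModule)); intros s _.
apply continuity_pt_filterlim, Hh.
Qed.

Lemma is_derive_RInt_weighted (q : R -> R) (F dF : R -> R -> R) (a b r : R) :
  (forall s, continuity_pt q s) ->
  (forall u s, 0 < u -> is_derive (fun v => F v s) u (dF u s)) ->
  (forall u s, 0 < u -> continuity_2d_pt F u s) ->
  (forall u s, 0 < u -> continuity_2d_pt dF u s) ->
  0 < r ->
  is_derive (fun u => RInt (fun s => q s * F u s) a b) r
    (RInt (fun s => q s * dF r s) a b).
Proof.
intros Hq HD HF HdF Hr.
assert (HD' : forall u s, 0 < u -> is_derive (fun v => q s * F v s) u (q s * dF u s)).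
{ intros; now apply is_derive_scal, HD. }
assert (Hloc : locally r (fun u => 0 < u)) by apply (open_gt 0 r Hr).
rewrite (RInt_ext _ (fun s => Derive (fun u => q s * F u s) r)).
- apply (is_derive_RInt_param (fun u s => q s * F u s)).
  + apply filter_imp with (2 := Hloc); intros u Hu s _.
    eexists; now apply HD'.
  + intros s _. apply (continuity_2d_pt_ext_loc (fun u v => q v * dF u v)).
    * exists (mkposreal r Hr); simpl; intros u v Hu _.
      symmetry; apply is_derive_unique, HD'. apply Rabs_def2 in Hu; lra.
    * apply continuity_2d_pt_mult; [now apply continuity_2d_pt_snd|now apply HdF].
  + apply filter_imp with (2 := Hloc); intros u Hu.
    apply ex_RInt_continuity; intros s; apply continuity_pt_mult; [apply Hq|].
    now apply continuity_pt_section, HF.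
- intros s _; symmetry; now apply is_derive_unique, HD'.
Qed.

(** [G] minus the primitive of [g] is continuous on [a, b] with zero derivative inside, hence
    constant. The derivative is asked only in the open interval because [cs] is not differentiable
    at -1 and 1. *)
Lemma RInt_derive_interior (G g : R -> R) (a b : R) :
  a < b -> (forall s, continuity_pt G s) -> (forall s, continuity_pt g s) ->
  (forall s, a < s < b -> is_derive G s (g s)) -> RInt g a b = G b - G a.
Proof.
intros Hab HG Hg HD.
assert (Hi : forall t, is_derive (RInt g a) t (g t)).
{ intros t; apply (is_derive_RInt g (RInt g a) a).
  - exists (mkposreal 1 Rlt_0_1); intros z _.
    now apply (RInt_correct (V := R_CompleteNormedModule)), ex_RInt_continuity.
  - apply continuity_pt_filterlim, Hg. }
destruct (MVT_gen (fun t => G t - RInt g a t) a b (fun _ => 0)) as [c [_ Hc]].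
- rewrite Rmin_left, Rmax_right by lra; intros s Hs.
  replace 0 with (g s - g s) by ring.
  apply (is_derive_minus G (RInt g a)); [now apply HD|apply Hi].
- intros s _; apply continuity_pt_minus; [apply HG|].
  apply continuity_pt_filterlim, (ex_derive_continuous (RInt g a)).
  eexists; apply Hi.
- rewrite RInt_point in Hc; unfold zero in Hc; simpl in Hc; lra.
Qed.

(* [dp] and [ddp] are the first two derivatives of (1 - s^2) q. In [G] below the
   terms with [1 / cs s], singular at the endpoints, have cancelled. *)
Lemma moment_by_parts (f fx fy fxx fxy fyx fyy : R -> R -> R) (q dq dp ddp : R -> R) (r : R) :
  axisymmetric_solution f fx fy fxx fxy fyx fyy -> 0 < r ->
  (forall s, is_derive q s (dq s)) ->
  (forall s, dp s = (1 - s ^ 2) * dq s - 2 * s * q s) ->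
  (forall s, is_derive dp s (ddp s)) ->
  (forall s, continuity_pt ddp s) ->
  r ^ 2 * RInt (fun s => q s * radial2 fxx fxy fyx fyy r s) (-1) 1 =
  - RInt (fun s => ddp s * polar f r s) (-1) 1.
Proof.
intros [Hf Hfx Hfy Hb Heq] Hr Hq Hdp Hddp Cddp.
assert (Cq : forall s, continuity_pt q s).
{ intros s; apply continuity_pt_filterlim, (ex_derive_continuous q); eexists; apply Hq. }
assert (Cdp : forall s, continuity_pt dp s).
{ intros s; apply continuity_pt_filterlim, (ex_derive_continuous dp); eexists; apply Hddp. }
assert (Cpol : forall g, cont_on H2bar g -> forall s, continuity_pt (polar g r) s).
{ intros; now apply continuity_pt_section, continuity_2d_polar. }
assert (Crad : forall s, continuity_pt (radial2 fxx fxy fyx fyy r) s).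
{ intros; apply continuity_pt_section, continuity_2d_radial2; trivial;
    solve [apply Hfx|apply Hfy]. }
assert (Cid : forall s, continuity_pt (fun s => s) s).
{ intros s; apply continuity_pt_id. }
(* Inside (-1, 1), [B] is (1 - s^2) f_s, with f_s the angular derivative of [polar f r]. *)
set (B := fun s => r * (cs s * (cs s * polar fy r s - s * polar fx r s))).
set (G := fun s => q s * B s - dp s * polar f r s).
set (g := fun s => - (r ^ 2 * (q s * radial2 fxx fxy fyx fyy r s))
                   - ddp s * polar f r s).
assert (CG : forall s, continuity_pt G s).
{ intros s; unfold G, B.
  apply continuity_pt_minus; apply continuity_pt_mult; auto;
    [|apply Cpol, Hf].
  apply continuity_pt_scal, continuity_pt_mult; [apply continuity_cs|].
  apply continuity_pt_minus; apply continuity_pt_mult; auto.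
  - apply continuity_cs.
  - apply Cpol, Hfy.
  - apply Cpol, Hfx. }
assert (Cg1 : forall s, continuity_pt (fun s => q s * radial2 fxx fxy fyx fyy r s) s).
{ intros s; apply continuity_pt_mult; auto. }
assert (Cg2 : forall s, continuity_pt (fun s => ddp s * polar f r s) s).
{ intros s; apply continuity_pt_mult; [auto|apply Cpol, Hf]. }
assert (Cg : forall s, continuity_pt g s).
{ intros s; unfold g. apply continuity_pt_minus; auto.
  apply continuity_pt_opp, continuity_pt_scal; auto. }
(* The equation amounts to B' = - r^2 f_rr - 2 s f_s, the mixed second partials cancelling against
   those in [radial2]. In G' the f_s terms then cancel by the formula for [dp]. *)
assert (DG : forall s, -1 < s < 1 -> is_derive G s (g s)).
{ intros s Hs.
  assert (Hc := cs_interior s Hs).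
  assert (Hc2 := cs_sq s ltac:(lra)).
  assert (D0 := is_derive_polar_angle f fx fy r s Hf Hs Hr).
  assert (Dx := is_derive_polar_angle fx fxx fxy r s Hfx Hs Hr).
  assert (Dy := is_derive_polar_angle fy fyx fyy r s Hfy Hs Hr).
  assert (Dc := is_derive_cs s Hs).
  (* The equation multiplied by x = r [cs s], which clears the singular coefficient. *)
  assert (E : fx (r * cs s) (r * s) =
              r * cs s * (fxx (r * cs s) (r * s) + fyy (r * cs s) (r * s))).
  { assert (H : 0 < r * cs s) by nra.
    replace (fxx (r * cs s) (r * s) + fyy (r * cs s) (r * s)) with
      (fx (r * cs s) (r * s) / (r * cs s))
      by (generalize (Heq (r * cs s) (r * s) H); lra).
    field; nra. }
  unfold G, B; auto_derive.
  - repeat split; eexists; eauto.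
  - change (fun x => q x) with q; change (fun x => dp x) with dp;
      change (fun x => cs x) with cs; change (fun x => polar f r x) with (polar f r);
      change (fun x => polar fx r x) with (polar fx r);
      change (fun x => polar fy r x) with (polar fy r).
    rewrite (is_derive_unique _ _ _ (Hq s)), (is_derive_unique _ _ _ (Hddp s)),
      (is_derive_unique _ _ _ D0), (is_derive_unique _ _ _ Dx),
      (is_derive_unique _ _ _ Dy), (is_derive_unique _ _ _ Dc).
    unfold g, radial2, radial. rewrite (Hdp s), <- Hc2.
    unfold polar. rewrite E. field; lra. }
assert (EG := RInt_derive_interior G g (-1) 1 ltac:(lra) CG Cg DG).
(* At both ends [B] has the factor [cs s] = 0, and [polar f r] takes a boundary value of [f]. *)
assert (Ends : forall s, cs s = 0 -> G s = 0).
{ intros s Hs; unfold G, B, polar; rewrite Hs, Rmult_0_r, Hb; ring. }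
rewrite !Ends in EG by (unfold cs; rewrite <- sqrt_0; f_equal; ring).
assert (I1 := RInt_correct (V := R_CompleteNormedModule) _ _ _ (ex_RInt_continuity _ (-1) 1 Cg1)).
assert (I2 := RInt_correct (V := R_CompleteNormedModule) _ _ _ (ex_RInt_continuity _ (-1) 1 Cg2)).
assert (I := is_RInt_minus _ _ _ _ _ _
  (is_RInt_opp _ _ _ _ (is_RInt_scal _ _ _ (r ^ 2) _ I1)) I2).
apply is_RInt_unique in I.
change (RInt g (-1) 1 =
  - (r ^ 2 * RInt (fun s => q s * radial2 fxx fxy fyx fyy r s) (-1) 1)
  - RInt (fun s => ddp s * polar f r s) (-1) 1) in I.
lra.
Qed.

(** * Moments and their differential equation *)

Definition moment (f : R -> R -> R) (k : nat) (r : R) : R :=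
  RInt (fun s => s ^ k * polar f r s) (-1) 1.

Lemma continuity_pow (k : nat) (s : R) : continuity_pt (fun s => s ^ k) s.
Proof.
apply continuity_pt_filterlim, (ex_derive_continuous (fun s => s ^ k)).
auto_derive; trivial.
Qed.

Lemma continuity_polar (g : R -> R -> R) (r s : R) :
  cont_on H2bar g -> 0 < r -> continuity_pt (polar g r) s.
Proof. intros; now apply continuity_pt_section, continuity_2d_polar. Qed.

Lemma continuity_moment (f : R -> R -> R) (k : nat) (r s : R) :
  cont_on H2bar f -> 0 < r -> continuity_pt (fun s => s ^ k * polar f r s) s.
Proof.
intros Hf Hr; apply continuity_pt_mult; [apply continuity_pow|now apply continuity_polar].
Qed.

(** The coefficients come from ((1 - s^2) s^k)'' = k (k-1) s^(k-2) - (k+1)(k+2) s^k. For k < 2 the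
    truncated index k - 2 is harmless, since its coefficient is 0. *)
Lemma moment_ode (f fx fy fxx fxy fyx fyy : R -> R -> R) (k : nat) :
  axisymmetric_solution f fx fy fxx fxy fyx fyy ->
  exists d dd : R -> R, forall r, 0 < r ->
    is_derive (moment f k) r (d r) /\ is_derive d r (dd r) /\
    r ^ 2 * dd r = INR (k + 1) * INR (k + 2) * moment f k r
                   - INR k * INR (k - 1) * moment f (k - 2) r.
Proof.
intros Hsol.
exists (fun r => RInt (fun s => s ^ k * radial fx fy r s) (-1) 1).
exists (fun r => RInt (fun s => s ^ k * radial2 fxx fxy fyx fyy r s) (-1) 1).
intros r Hr; pose proof Hsol as [Hf Hfx Hfy Hb _].
split; [|split].
- apply (is_derive_RInt_weighted (fun s => s ^ k) (polar f) (radial fx fy)); trivial.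
  + apply continuity_pow.
  + intros; now apply is_derive_polar.
  + intros; apply continuity_2d_polar; trivial; apply Hf.
  + intros; apply continuity_2d_radial; trivial; apply Hf.
- apply (is_derive_RInt_weighted (fun s => s ^ k) (radial fx fy)); trivial.
  + apply continuity_pow.
  + intros; now apply (is_derive_radial f).
  + intros; apply continuity_2d_radial; trivial; apply Hf.
  + intros; apply continuity_2d_radial2; trivial; solve [apply Hfx|apply Hfy].
- rewrite (moment_by_parts f fx fy fxx fxy fyx fyy (fun s => s ^ k)
    (fun s => INR k * s ^ (k - 1))
    (fun s => INR k * s ^ (k - 1) - INR (k + 2) * s ^ (k + 1))
    (fun s => INR k * INR (k - 1) * s ^ (k - 2) - INR (k + 1) * INR (k + 2) * s ^ k));
    trivial.
  + unfold moment.
    assert (I1 := RInt_correct (V := R_CompleteNormedModule) _ (-1) 1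
      (ex_RInt_continuity _ _ _ (fun s => continuity_moment f k r s (partials_cont _ _ _ Hf) Hr))).
    assert (I2 := RInt_correct (V := R_CompleteNormedModule) _ (-1) 1
      (ex_RInt_continuity _ _ _ (fun s => continuity_moment f (k - 2) r s (partials_cont _ _ _ Hf) Hr))).
    assert (I := is_RInt_minus _ _ _ _ _ _
      (is_RInt_scal _ _ _ (INR k * INR (k - 1)) _ I2)
      (is_RInt_scal _ _ _ (INR (k + 1) * INR (k + 2)) _ I1)).
    assert (E : RInt (fun s => (INR k * INR (k - 1) * s ^ (k - 2)
                  - INR (k + 1) * INR (k + 2) * s ^ k) * polar f r s) (-1) 1 =
      INR k * INR (k - 1) * RInt (fun s => s ^ (k - 2) * polar f r s) (-1) 1
      - INR (k + 1) * INR (k + 2) * RInt (fun s => s ^ k * polar f r s) (-1) 1).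
    { apply is_RInt_unique. apply (is_RInt_ext _ _ _ _ _) with (2 := I).
      intros s _; unfold minus, plus, opp, scal; simpl; unfold mult; simpl; ring. }
    rewrite E; ring.
  + intros s; auto_derive; trivial. rewrite Nat.sub_1_r; ring.
  + intros s; destruct k as [|k]; [simpl; ring|].
    replace (S k - 1)%nat with k by lia.
    rewrite !plus_INR, !S_INR, !pow_add; simpl; ring.
  + intros s; auto_derive; trivial.
    destruct k as [|[|k]].
    * simpl; ring.
    * simpl; ring.
    * replace (S (S k) - 1)%nat with (S k) by lia.
      replace (S (S k) - 2)%nat with k by lia.
      replace (S (S k) + 1)%nat with (S (S (S k))) by lia.
      rewrite !plus_INR, !S_INR; simpl; ring.
  + intros s; apply continuity_pt_minus; apply continuity_pt_scal, continuity_pow.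
Qed.

(** * Euler equations with solutions bounded at the origin *)

Lemma constant_of_derive_0 (h : R -> R) :
  (forall r, 0 < r -> is_derive h r 0) -> forall r, 0 < r -> h r = h 1.
Proof.
intros Hh r Hr.
assert (P : 0 < Rmin 1 r) by (apply Rmin_pos; lra).
destruct (MVT_gen h 1 r (fun _ => 0)) as [c [_ Hc]]; [| |lra].
- intros x Hx; apply Hh; lra.
- intros x Hx; apply continuity_pt_filterlim, (ex_derive_continuous h).
  eexists; apply Hh; lra.
Qed.

(* [r J' - (p+1) J] and [r J' + p J] are multiples of [r^(-p)] and [r^(p+1)];
   boundedness at [0] kills the first. *)
Lemma euler_ode_bounded_at_0 (J d dd : R -> R) (p : nat) (K delta : R) :
  (1 <= p)%nat -> 0 < delta ->
  (forall r, 0 < r -> is_derive J r (d r)) ->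
  (forall r, 0 < r -> is_derive d r (dd r)) ->
  (forall r, 0 < r -> r ^ 2 * dd r = INR p * INR (p + 1) * J r) ->
  (forall r, 0 < r < delta -> Rabs (J r) <= K) ->
  exists c, forall r, 0 < r -> J r = c * r ^ (p + 1).
Proof.
intros Hp Hdelta HJ Hd Hode HK.
set (m := INR p) in *.
assert (Hm : INR (p + 1) = m + 1) by (rewrite plus_INR; simpl; reflexivity).
assert (Hm0 : 1 <= m) by (apply (le_INR 1); exact Hp).
rewrite Hm in Hode.
destruct p as [|p]; [lia|].
set (U := fun r => r ^ S p * (r * d r - (m + 1) * J r)).
set (V := fun r => / r ^ (S p + 1) * (r * d r + m * J r)).
assert (HU : forall r, 0 < r -> U r = U 1).
{ apply constant_of_derive_0; intros r Hr; unfold U; auto_derive.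
  - split; [|split; trivial]; eexists; eauto.
  - change (fun x => d x) with d; change (fun x => J x) with J.
    rewrite (is_derive_unique _ _ _ (Hd r Hr)), (is_derive_unique _ _ _ (HJ r Hr)).
    (* The match is [INR (S p)] as unfolded by [auto_derive]. *)
    change (match p with 0%nat => 1 | S _ => INR p + 1 end) with m.
    transitivity (r ^ p * (r ^ 2 * dd r - m * (m + 1) * J r)); [simpl; ring|].
    rewrite (Hode r Hr); ring. }
assert (HV : forall r, 0 < r -> V r = V 1).
{ apply constant_of_derive_0; intros r Hr; unfold V; auto_derive.
  - split; [|split; [|split; trivial]].
    + apply (pow_nonzero r (S p + 1)); lra.
    + eexists; eauto.
    + eexists; eauto.
  - change (fun x => d x) with d; change (fun x => J x) with J.
    rewrite (is_derive_unique _ _ _ (Hd r Hr)), (is_derive_unique _ _ _ (HJ r Hr)).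
    change (match (p + 1)%nat with 0%nat => 1 | S _ => INR (p + 1) + 1 end)
      with (INR (S p + 1)).
    rewrite Hm.
    assert (Hw : r ^ (p + 1) <> 0) by (apply pow_nonzero; lra).
    generalize dependent (r ^ (p + 1)); intros w Hw.
    transitivity ((r ^ 2 * dd r - m * (m + 1) * J r) / (w * r * r)); [field; lra|].
    rewrite (Hode r Hr); field; lra. }
(* Eliminating [d] between the two constants of integration expresses [J] through [U 1] and
   [V 1]. *)
assert (HVU : forall r, 0 < r ->
  U 1 = r ^ S p * (V 1 * r ^ (S p + 1) - (2 * m + 1) * J r)).
{ intros r Hr; rewrite <- (HU r Hr), <- (HV r Hr); unfold U, V.
  field; apply pow_nonzero; lra. }
assert (U0 : U 1 = 0).
{ destruct (Req_dec (U 1) 0) as [E|E]; [exact E|exfalso].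
  assert (HU1 := Rabs_pos_lt _ E).
  (* For r <= 1 and r < delta the relation [HVU] bounds |U 1| by r L, which a small [r] makes less
     than |U 1|. The summand 1 keeps [L] positive. *)
  set (L := Rabs (V 1) + (2 * m + 1) * Rabs K + 1).
  assert (HL : 0 < L).
  { unfold L; pose proof (Rabs_pos (V 1)); pose proof (Rabs_pos K); nra. }
  set (r := Rmin (Rmin delta 1) (Rabs (U 1) / L) / 2).
  assert (Hr : 0 < r /\ r < delta /\ r <= 1 /\ r * L < Rabs (U 1)).
  { assert (0 < Rabs (U 1) / L) by now apply Rdiv_lt_0_compat.
    assert (0 < Rmin (Rmin delta 1) (Rabs (U 1) / L)) by (repeat apply Rmin_pos; lra).
    pose proof (Rmin_l (Rmin delta 1) (Rabs (U 1) / L)).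
    pose proof (Rmin_r (Rmin delta 1) (Rabs (U 1) / L)).
    pose proof (Rmin_l delta 1); pose proof (Rmin_r delta 1).
    unfold r; repeat split; try lra.
    apply Rlt_le_trans with (Rabs (U 1) / L * L); [|right; field; lra].
    apply Rmult_lt_compat_r; lra. }
  destruct Hr as [Hr [Hrd [Hr1 HrL]]].
  assert (HKr := HK r (conj Hr Hrd)).
  assert (HKK := Rle_abs K).
  assert (Q : forall n, 0 <= r ^ n <= 1).
  { intros n; split; [apply pow_le; lra|].
    rewrite <- (pow1 n); apply pow_incr; lra. }
  assert (T : Rabs (U 1) <= r * (Rabs (V 1) + (2 * m + 1) * Rabs K)).
  { rewrite (HVU r Hr), Rabs_mult, (Rabs_pos_eq (r ^ S p)) by apply Q.
    apply Rmult_le_compat; try apply Rabs_pos; try apply Q.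
    - simpl; pose proof (Q p); nra.
    - unfold Rminus; eapply Rle_trans; [apply Rabs_triang|].
      rewrite Rabs_Ropp, !Rabs_mult.
      rewrite (Rabs_pos_eq (2 * m + 1)), (Rabs_pos_eq (r ^ (S p + 1))) by (try apply Q; lra).
      pose proof (Q (S p + 1)%nat); pose proof (Rabs_pos (V 1)).
      apply Rplus_le_compat; [nra|].
      apply Rmult_le_compat_l; lra. }
  unfold L in HrL; nra. }
exists (V 1 / (2 * m + 1)); intros r Hr.
assert (H := HVU r Hr); rewrite U0 in H.
symmetry in H; apply Rmult_integral in H; destruct H as [H|H].
- exfalso; revert H; apply pow_nonzero; lra.
- apply Rmult_eq_reg_l with (2 * m + 1); [|lra].
  transitivity (V 1 * r ^ (S p + 1)); [lra|field; lra].
Qed.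

(** * Vanishing of the moments *)

Lemma abs_pow_le_1 (k : nat) (s : R) : -1 <= s <= 1 -> Rabs (s ^ k) <= 1.
Proof.
intros Hs; rewrite <- RPow_abs, <- (pow1 k); apply pow_incr.
split; [apply Rabs_pos|apply Rabs_le; lra].
Qed.

Lemma moment_bounded_at_0 (f : R -> R -> R) (k : nat) :
  cont_on H2bar f -> f 0 0 = 0 ->
  exists delta, 0 < delta /\ forall r, 0 < r < delta -> Rabs (moment f k r) <= 2.
Proof.
intros Hf H0.
destruct (Hf 0 0 (Rle_refl 0) 1 Rlt_0_1) as [delta [Hdelta H]].
exists delta; split; trivial; intros r Hr.
replace 2 with ((1 - -1) * 1) by ring.
apply abs_RInt_le_const; [lra| |].
- apply ex_RInt_continuity; intros; apply continuity_moment; trivial; lra.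
- intros s Hs.
  assert (Hc := cs_pos s); assert (Hc2 := cs_sq s Hs).
  assert (cs s <= 1) by nra.
  assert (B := H (r * cs s) (r * s)).
  rewrite H0, !Rminus_0_r in B.
  assert (Rabs (polar f r s) < 1).
  { apply B; [unfold H2bar; nra| |]; apply Rabs_def1; nra. }
  rewrite Rabs_mult; assert (P := abs_pow_le_1 k s Hs).
  pose proof (Rabs_pos (s ^ k)); pose proof (Rabs_pos (polar f r s)); nra.
Qed.

(** Euler equation with p = k + 1. For k = 0 and k = 1 the inhomogeneous term has coefficient 0,
    which starts two inductive chains, one for each parity. *)
Lemma moment_power (f fx fy fxx fxy fyx fyy : R -> R -> R) (k : nat) :
  axisymmetric_solution f fx fy fxx fxy fyx fyy ->
  ((2 <= k)%nat -> forall r, 0 < r -> moment f (k - 2) r = 0) ->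
  exists c, forall r, 0 < r -> moment f k r = c * r ^ (k + 2).
Proof.
intros Hsol Hprev.
destruct (moment_ode _ _ _ _ _ _ _ k Hsol) as [d [dd Hode]].
destruct (moment_bounded_at_0 f k) as [delta [Hdelta Hb]].
{ apply Hsol. } { apply Hsol. }
destruct (euler_ode_bounded_at_0 (moment f k) d dd (k + 1) 2 delta) as [c Hc]; trivial.
- lia.
- intros r Hr; apply Hode, Hr.
- intros r Hr; apply Hode, Hr.
- intros r Hr; destruct (Hode r Hr) as [_ [_ E]]; rewrite E.
  replace (k + 1 + 1)%nat with (k + 2)%nat by lia.
  destruct k as [|[|k]]; [simpl; ring|simpl; ring|].
  rewrite Hprev by (trivial; lia); ring.
- exists c; intros r Hr; rewrite (Hc r Hr); do 2 f_equal; lia.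
Qed.

(** For k >= 1 a multiple of r^(k+2) bounded by C r^2 for all r must be zero, by letting r grow. The
    case k = 0 is settled by the value at r = 1. *)
Lemma moments_vanish (f fx fy fxx fxy fyx fyy : R -> R -> R) (C : R) :
  axisymmetric_solution f fx fy fxx fxy fyx fyy ->
  moment f 0 1 = 0 ->
  (forall k r, 0 < r -> Rabs (moment f k r) <= C * r ^ 2) ->
  forall k r, 0 < r -> moment f k r = 0.
Proof.
intros Hsol H0 HC k; induction k as [k IH] using lt_wf_ind.
destruct (moment_power _ _ _ _ _ _ _ k Hsol) as [c Hc].
{ intros Hk; apply IH; lia. }
enough (c = 0) as E by (intros r Hr; rewrite (Hc r Hr), E; ring).
destruct k as [|k].
- specialize (Hc 1 Rlt_0_1); rewrite pow1, H0 in Hc; lra.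
- destruct (Req_dec c 0) as [E|E]; [exact E|exfalso].
  assert (Hcp := Rabs_pos_lt _ E).
  (* This [r] is at least 1 and satisfies |c| r = |C| + |c| > C, whereas dividing the bound by r^2
     leaves |c| r^(k+1) <= C. *)
  set (r := Rabs C / Rabs c + 1).
  assert (Hr : 1 <= r).
  { pose proof (Rdiv_le_0_compat (Rabs C) (Rabs c) (Rabs_pos _) Hcp); unfold r; lra. }
  assert (HrC : Rabs c * r = Rabs C + Rabs c) by (unfold r; field; lra).
  specialize (HC (S k) r ltac:(lra)).
  rewrite Hc, Rabs_mult, (Rabs_pos_eq (r ^ _)) in HC by (trivial; try apply pow_le; lra).
  replace (S k + 2)%nat with (k + 1 + 2)%nat in HC by lia.
  rewrite (pow_add r (k + 1)), (pow_add r k), pow_1 in HC.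
  assert (1 <= r ^ k) by now apply pow_R1_Rle.
  assert (0 < r ^ 2) by (apply pow_lt; lra).
  assert (Rabs c * (r ^ k * r) <= C).
  { apply Rmult_le_reg_r with (r ^ 2); trivial; lra. }
  assert (Rabs c * r * 1 <= Rabs c * r * r ^ k).
  { apply Rmult_le_compat_l; trivial; rewrite HrC; pose proof (Rabs_pos C); lra. }
  pose proof (Rle_abs C); lra.
Qed.

(** * A continuous function with vanishing moments *)

(* A polynomial that exceeds 1 near [s0] and lies in [0, 1] on the rest of
   [-1, 1]: its powers concentrate at [s0]. *)
Definition peak (s0 d s : R) : R := 1 + d ^ 2 / 8 - (s - s0) ^ 2 / 4.

(** [peak] is quadratic in s, so one more factor combines the integrals for k, k+1 and k+2; hence
    the induction on [n] with [k] general. *)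
Lemma RInt_peak_0 (h : R -> R) (s0 d : R) :
  (forall s, continuity_pt h s) ->
  (forall k, RInt (fun s => s ^ k * h s) (-1) 1 = 0) ->
  forall n k, is_RInt (fun s => s ^ k * (peak s0 d s ^ n * h s)) (-1) 1 0.
Proof.
intros Hh H n; induction n as [|n IH]; intros k.
- apply (is_RInt_ext (fun s => s ^ k * h s)); [intros; simpl; ring|].
  rewrite <- (H k); apply (RInt_correct (V := R_CompleteNormedModule)).
  apply ex_RInt_continuity; intros s; apply continuity_pt_mult; trivial.
  apply continuity_pow.
- assert (I := is_RInt_plus _ _ _ _ _ _
    (is_RInt_plus _ _ _ _ _ _
      (is_RInt_scal _ _ _ (1 + d ^ 2 / 8 - s0 ^ 2 / 4) _ (IH k))
      (is_RInt_scal _ _ _ (s0 / 2) _ (IH (k + 1)%nat)))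
    (is_RInt_scal _ _ _ (- / 4) _ (IH (k + 2)%nat))).
  replace 0 with (plus (plus (scal (1 + d ^ 2 / 8 - s0 ^ 2 / 4) 0) (scal (s0 / 2) 0))
                    (scal (- / 4) 0)).
  + apply (is_RInt_ext _ _ _ _ _) with (2 := I).
    intros s _; unfold plus, scal; simpl; unfold mult; simpl.
    rewrite !pow_add; unfold peak; simpl; field.
  + unfold plus, scal; simpl; unfold mult; simpl; ring.
Qed.

(** On the middle interval of length [d] the peak is at least 1 + d^2/8 - d^2/16. Elsewhere the
    integrand is at least -M: either |s - s0| < d and [h] is positive, or the peak lies in [0, 1].
    The remaining length is at most 2. *)
Lemma RInt_pow_peak_lower (h : R -> R) (s0 d e M : R) (n : nat) :
  (forall s, continuity_pt h s) -> 0 < d <= 1 -> 0 <= M -> 0 < e ->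
  -1 < s0 - d / 2 -> s0 + d / 2 < 1 ->
  (forall s, -1 <= s <= 1 -> - M <= h s) ->
  (forall s, -1 <= s <= 1 -> Rabs (s - s0) < d -> e <= h s) ->
  e * (1 + d ^ 2 / 16) ^ n * d - 2 * M <=
  RInt (fun s => peak s0 d s ^ n * h s) (-1) 1.
Proof.
intros Hh Hd HM He Hl Hr Hlow Hnear.
assert (Hc : forall s, continuity_pt (fun s => peak s0 d s ^ n * h s) s).
{ intros s; apply continuity_pt_mult; trivial.
  apply continuity_pt_filterlim, (ex_derive_continuous (fun s => peak s0 d s ^ n)).
  unfold peak; auto_derive; trivial. }
assert (Hi : forall a b, ex_RInt (fun s => peak s0 d s ^ n * h s) a b).
{ intros; now apply ex_RInt_continuity. }
assert (Hs0 : -1 < s0 < 1) by lra.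
assert (Hpt : forall s, -1 <= s <= 1 -> - M <= peak s0 d s ^ n * h s).
{ intros s Hs.
  assert (Hs2 : -2 <= s - s0 <= 2) by lra.
  assert (Hp0 : 0 <= peak s0 d s) by (unfold peak; nra).
  assert (Hp := pow_le _ n Hp0).
  destruct (Rlt_dec (Rabs (s - s0)) d) as [H|H].
  - specialize (Hnear s Hs H); nra.
  - assert (d ^ 2 <= (s - s0) ^ 2).
    { rewrite <- (pow2_abs (s - s0)); apply pow_incr; lra. }
    assert (peak s0 d s ^ n <= 1).
    { rewrite <- (pow1 n); apply pow_incr; unfold peak in *; split; trivial; nra. }
    specialize (Hlow s Hs); nra. }
assert (Hmid : forall s, s0 - d / 2 <= s <= s0 + d / 2 ->
  e * (1 + d ^ 2 / 16) ^ n <= peak s0 d s ^ n * h s).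
{ intros s Hs.
  assert (Hn : e <= h s) by (apply Hnear; [lra|apply Rabs_def1; lra]).
  assert (H1 : 1 + d ^ 2 / 16 <= peak s0 d s) by (unfold peak; nra).
  assert (H0 : 0 <= 1 + d ^ 2 / 16) by nra.
  assert (H2 : (1 + d ^ 2 / 16) ^ n <= peak s0 d s ^ n) by (apply pow_incr; lra).
  assert (H3 := pow_le _ n H0).
  rewrite (Rmult_comm e); apply Rmult_le_compat; lra. }
assert (Hconst : forall a b c, a <= b ->
  (forall s, a < s < b -> c <= peak s0 d s ^ n * h s) ->
  (b - a) * c <= RInt (fun s => peak s0 d s ^ n * h s) a b).
{ intros a b c Hab H.
  replace ((b - a) * c) with (RInt (fun _ => c) a b) by (rewrite RInt_const; reflexivity).
  apply RInt_le; trivial; apply ex_RInt_const. }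
rewrite <- (RInt_Chasles _ _ (s0 - d / 2) _ (Hi _ _) (Hi _ _)).
rewrite <- (RInt_Chasles _ (s0 - d / 2) (s0 + d / 2) _ (Hi _ _) (Hi _ _)).
change (@plus R_CompleteNormedModule) with Rplus; cbv beta.
assert (A1 := Hconst (-1) (s0 - d / 2) (- M) ltac:(lra)
                (fun s Hs => Hpt s ltac:(lra))).
assert (A2 := Hconst (s0 - d / 2) (s0 + d / 2) _ ltac:(lra)
                (fun s Hs => Hmid s ltac:(lra))).
assert (A3 := Hconst (s0 + d / 2) 1 (- M) ltac:(lra)
                (fun s Hs => Hpt s ltac:(lra))).
assert (0 <= M * d) by nra.
lra.
Qed.

(** If h(s0) > 0, the integrals of [h] against powers of the peak at s0 become positive, although
    linearity makes them all 0. *)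
Lemma vanishing_moments_le_0 (h : R -> R) :
  (forall s, continuity_pt h s) ->
  (forall k, RInt (fun s => s ^ k * h s) (-1) 1 = 0) ->
  forall s, -1 < s < 1 -> h s <= 0.
Proof.
intros Hh H s0 Hs0.
apply Rnot_lt_le; intros Hpos.
destruct (continuity_ab_min h (-1) 1) as [sm [Hmin _]]; [lra|auto|].
assert (Hloc := proj1 (continuity_pt_locally h s0) (Hh s0) (mkposreal (h s0 / 2) ltac:(lra))).
destruct Hloc as [d0 Hd0]; simpl in Hd0.
set (d := Rmin (Rmin d0 1) (Rmin (1 - s0) (1 + s0))).
assert (Hd : 0 < d /\ d <= d0 /\ d <= 1 /\ d <= 1 - s0 /\ d <= 1 + s0).
{ pose proof (cond_pos d0).
  pose proof (Rmin_l (Rmin d0 1) (Rmin (1 - s0) (1 + s0))).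
  pose proof (Rmin_r (Rmin d0 1) (Rmin (1 - s0) (1 + s0))).
  pose proof (Rmin_l d0 1); pose proof (Rmin_r d0 1).
  pose proof (Rmin_l (1 - s0) (1 + s0)); pose proof (Rmin_r (1 - s0) (1 + s0)).
  fold d in H1, H2.
  repeat split; try lra.
  unfold d; repeat apply Rmin_pos; lra. }
set (M := Rabs (h sm)).
assert (HM := Rabs_pos (h sm)); fold M in HM.
(* This power makes the lower bound of [RInt_pow_peak_lower] at least 2M + 1 - 2M = 1. *)
destruct (Pow_x_infinity (1 + d ^ 2 / 16)) with (b := (2 * M + 1) / (h s0 / 2 * d)) as [n Hn].
{ rewrite Rabs_pos_eq; nra. }
specialize (Hn n (Nat.le_refl n)).
rewrite Rabs_pos_eq in Hn by (apply pow_le; nra).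
assert (L := RInt_pow_peak_lower h s0 d (h s0 / 2) M n Hh ltac:(lra) HM ltac:(lra)
  ltac:(lra) ltac:(lra)).
assert (I : RInt (fun s => peak s0 d s ^ n * h s) (-1) 1 = 0).
{ apply is_RInt_unique, (is_RInt_ext (fun s => s ^ 0 * (peak s0 d s ^ n * h s))).
  - intros s _; apply Rmult_1_l.
  - now apply RInt_peak_0. }
rewrite I in L.
assert (E : 2 * M + 1 = (2 * M + 1) / (h s0 / 2 * d) * (h s0 / 2 * d)) by (field; lra).
assert (0 < h s0 / 2 * d) by nra.
assert (2 * M + 1 <= (1 + d ^ 2 / 16) ^ n * (h s0 / 2 * d)).
{ rewrite E; apply Rmult_le_compat_r; lra. }
enough (h s0 / 2 * (1 + d ^ 2 / 16) ^ n * d - 2 * M <= 0) by lra.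
apply L.
- intros s Hs; assert (h sm <= h s) by (apply Hmin; lra).
  assert (- M <= h sm); [|lra]. unfold M; pose proof (Rabs_maj2 (h sm)); lra.
- intros s Hs Hsd.
  assert (B := Hd0 s ltac:(unfold ball; simpl; unfold AbsRing_ball, abs, minus, plus, opp; simpl; unfold Rminus in *; lra)).
  apply Rabs_def2 in B; lra.
Qed.

Lemma vanishing_moments (h : R -> R) :
  (forall s, continuity_pt h s) ->
  (forall k, RInt (fun s => s ^ k * h s) (-1) 1 = 0) ->
  forall s, -1 < s < 1 -> h s = 0.
Proof.
intros Hh H s Hs; apply Rle_antisym; [now apply vanishing_moments_le_0|].
enough (- h s <= 0) by lra.
apply (vanishing_moments_le_0 (fun s => - h s)); trivial.
- intros t; now apply continuity_pt_opp.
- intros k; rewrite <- (Ropp_involutive 0), Ropp_0, <- (H k).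
  rewrite <- (RInt_opp (V := R_CompleteNormedModule)).
  + apply RInt_ext; intros t _; unfold opp; simpl; ring.
  + apply ex_RInt_continuity; intros t; apply continuity_pt_mult; trivial.
    apply continuity_pow.
Qed.

(** * Subtracting the multiple of x^2 and concluding *)

Lemma axisymmetric_solution_minus_sq (f fx fy fxx fxy fyx fyy : R -> R -> R) (A : R) :
  axisymmetric_solution f fx fy fxx fxy fyx fyy ->
  axisymmetric_solution (fun x y => f x y - A * x ^ 2)
    (fun x y => fx x y - 2 * A * x) (fun x y => fy x y - 0)
    (fun x y => fxx x y - 2 * A) (fun x y => fxy x y - 0)
    (fun x y => fyx x y - 0) (fun x y => fyy x y - 0).
Proof.
intros [Hf Hfx Hfy Hb Heq]; split.
- apply (has_partials_minus _ _ _ _ _ _ Hf (has_partials_sq A)).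
- apply (has_partials_minus _ _ _ _ _ _ Hfx (has_partials_linear (2 * A))).
- apply (has_partials_minus _ _ _ _ _ _ Hfy (has_partials_const 0)).
- intros y; rewrite Hb; ring.
- intros x y Hx; transitivity (fxx x y + fyy x y - fx x y / x); [field; lra|now apply Heq].
Qed.

(** In polar coordinates x^2 is r^2 (1 - s^2), and 1 - s^2 has integral 4/3 over [-1, 1]. *)
Lemma moment_0_minus_sq (f : R -> R -> R) (A r : R) :
  cont_on H2bar f -> 0 < r ->
  moment (fun x y => f x y - A * x ^ 2) 0 r = moment f 0 r - 4 / 3 * A * r ^ 2.
Proof.
intros Hf Hr; apply is_RInt_unique.
assert (I1 : is_RInt (fun s => s ^ 0 * polar f r s) (-1) 1 (moment f 0 r)).
{ apply (RInt_correct (V := R_CompleteNormedModule)), ex_RInt_continuity.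
  intros; now apply continuity_moment. }
set (P := fun s => A * r ^ 2 * (s - s ^ 3 / 3)).
assert (I2 : is_RInt (fun s => A * r ^ 2 * (1 - s ^ 2)) (-1) 1 (minus (P 1) (P (-1)))).
{ apply (is_RInt_derive P).
  - intros s _; unfold P; auto_derive; trivial; field.
  - intros s _; apply (ex_derive_continuous (fun s => A * r ^ 2 * (1 - s ^ 2))).
    auto_derive; trivial. }
assert (I := is_RInt_minus _ _ _ _ _ _ I1 I2).
replace (minus (P 1) (P (-1))) with (4 / 3 * A * r ^ 2) in I
  by (unfold P, minus, plus, opp; simpl; field).
apply (is_RInt_ext _ _ _ _ _) with (2 := I).
intros s Hs; rewrite Rmin_left, Rmax_right in Hs by lra.
rewrite <- (cs_sq s) by lra.
unfold minus, plus, opp, polar; simpl; ring.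
Qed.

(** Positivity turns |f| into f, so the zeroth moment dominates; |s^k| <= 1, x^2 <= r^2 and the
    length 2 of the interval give the rest. *)
Lemma moment_le_moment_0 (f : R -> R -> R) (A r : R) (k : nat) :
  cont_on H2bar f -> (forall x y, 0 <= x -> 0 <= f x y) -> 0 < r ->
  Rabs (moment (fun x y => f x y - A * x ^ 2) k r) <=
  moment f 0 r + 2 * Rabs A * r ^ 2.
Proof.
intros Hf Hpos Hr.
assert (Hg : cont_on H2bar (fun x y => f x y - A * x ^ 2)).
{ apply cont_on_minus; [exact Hf|apply (has_partials_sq A)]. }
assert (I1 : is_RInt (fun s => s ^ 0 * polar f r s) (-1) 1 (moment f 0 r)).
{ apply (RInt_correct (V := R_CompleteNormedModule)), ex_RInt_continuity.
  intros; now apply continuity_moment. }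
assert (I := is_RInt_plus _ _ _ _ _ _ I1 (is_RInt_const (-1) 1 (Rabs A * r ^ 2))).
assert (E : RInt (fun s => s ^ 0 * polar f r s + Rabs A * r ^ 2) (-1) 1 =
            moment f 0 r + 2 * Rabs A * r ^ 2).
{ transitivity (plus (moment f 0 r) (scal (1 - -1) (Rabs A * r ^ 2))).
  - apply is_RInt_unique, I.
  - unfold plus, scal; simpl; unfold mult; simpl; ring. }
rewrite <- E.
assert (Hc : forall s, continuity_pt
  (fun s => s ^ k * polar (fun x y => f x y - A * x ^ 2) r s) s).
{ intros; now apply continuity_moment. }
eapply Rle_trans; [apply abs_RInt_le; [lra|now apply ex_RInt_continuity]|].
apply RInt_le; [lra| |eexists; exact I|].
- apply ex_RInt_continuity; intros s.
  apply (continuity_pt_comp _ Rabs); [apply Hc|apply Rcontinuity_abs].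
- intros s Hs.
  assert (Hk := abs_pow_le_1 k s ltac:(lra)).
  assert (Hc0 := cs_pos s); assert (Hc2 := cs_sq s ltac:(lra)).
  assert (H0 : 0 <= f (r * cs s) (r * s)) by (apply Hpos; nra).
  rewrite Rabs_mult, pow_O, Rmult_1_l; unfold polar.
  apply Rle_trans with (1 * Rabs (f (r * cs s) (r * s) - A * (r * cs s) ^ 2)).
  { apply Rmult_le_compat_r; [apply Rabs_pos|exact Hk]. }
  rewrite Rmult_1_l; unfold Rminus.
  eapply Rle_trans; [apply Rabs_triang|].
  rewrite Rabs_Ropp, (Rabs_pos_eq _ H0), Rabs_mult.
  apply Rplus_le_compat_l, Rmult_le_compat_l; [apply Rabs_pos|].
  rewrite Rabs_pos_eq by apply pow2_ge_0.
  replace ((r * cs s) ^ 2) with (r ^ 2 * (cs s * cs s)) by ring.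
  rewrite Hc2; nra.
Qed.

Lemma polar_coordinates (x y : R) :
  0 < x -> exists r s, 0 < r /\ -1 < s < 1 /\ x = r * cs s /\ y = r * s.
Proof.
intros Hx.
set (r := sqrt (x ^ 2 + y ^ 2)).
assert (Hr : 0 < r) by (apply sqrt_lt_R0; nra).
assert (Hr2 : r * r = x ^ 2 + y ^ 2) by (apply sqrt_sqrt; nra).
assert (Hy : - r < y < r) by (split; nra).
assert (Hs : -1 < y / r < 1).
{ split; apply Rmult_lt_reg_r with r; trivial; unfold Rdiv;
    rewrite Rmult_assoc, Rinv_l by lra; lra. }
exists r, (y / r); split; [exact Hr|]; split; [exact Hs|].
split; [|field; lra].
apply Rsqr_inj; [lra|pose proof (cs_pos (y / r)); nra|]; unfold Rsqr.
transitivity (r * r * (cs (y / r) * cs (y / r))); [|ring].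
rewrite cs_sq by lra.
transitivity (r * r - y ^ 2); [lra|field; lra].
Qed.

Lemma axisymmetric_solution_vanishing_moments (f fx fy fxx fxy fyx fyy : R -> R -> R) :
  axisymmetric_solution f fx fy fxx fxy fyx fyy ->
  (forall k r, 0 < r -> moment f k r = 0) ->
  forall x y, 0 <= x -> f x y = 0.
Proof.
intros Hsol H x y [Hx|Hx]; [|rewrite <- Hx; apply Hsol].
destruct (polar_coordinates x y Hx) as [r [s [Hr [Hs [-> ->]]]]].
change (polar f r s = 0).
apply vanishing_moments; [|intros k; now apply H|exact Hs].
intros t; apply continuity_polar; trivial; apply Hsol.
Qed.

Lemma nonnegative_axisymmetric_solution (f fx fy fxx fxy fyx fyy : R -> R -> R) :
  axisymmetric_solution f fx fy fxx fxy fyx fyy ->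
  (forall x y, 0 <= x -> 0 <= f x y) ->
  exists A, 0 <= A /\ forall x y, 0 <= x -> f x y = A * x ^ 2.
Proof.
intros Hsol Hpos.
assert (Hf : cont_on H2bar f) by apply Hsol.
destruct (moment_power _ _ _ _ _ _ _ 0 Hsol) as [a Ha]; [lia|]; change (0 + 2)%nat with 2%nat in Ha.
(* The zeroth moment of x^2 is 4/3 r^2, so this [A] cancels the zeroth moment a r^2 of [f]. *)
set (A := 3 / 4 * a).
assert (HsolA := axisymmetric_solution_minus_sq _ _ _ _ _ _ _ A Hsol).
assert (Hm := moments_vanish _ _ _ _ _ _ _ (a + 2 * Rabs A) HsolA).
assert (Hz := axisymmetric_solution_vanishing_moments _ _ _ _ _ _ _ HsolA).
assert (HA : forall x y, 0 <= x -> f x y = A * x ^ 2).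
{ intros x y Hx; apply Rminus_diag_uniq.
  apply (fun H => Hz H x y Hx), Hm.
  - rewrite moment_0_minus_sq, (Ha 1) by (trivial; lra); unfold A; field.
  - intros k r Hr; eapply Rle_trans; [now apply moment_le_moment_0|].
    rewrite (Ha r Hr); right; ring. }
exists A; split; [|exact HA].
(* Evaluation at (1, 0) gives A = f(1, 0) >= 0. *)
generalize (HA 1 0 Rle_0_1), (Hpos 1 0 Rle_0_1); lra.
Qed.

Theorem theorem4p15 (phi : R -> R -> R) :
  Ck 2 H2 H2bar phi ->
  Cinf H2 phi ->
  (forall x y, H2bar x y -> 0 <= phi x y) ->
  (forall y, phi 0 y = 0) ->
  (* phi_xx + phi_yy - phi_x / x = 0 on H^2 *)
  (forall phix phiy : R -> R -> R,
     (forall x y, H2 x y -> derivable_pt_lim (fun t => phi t y) x (phix x y)) ->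
     (forall x y, H2 x y -> derivable_pt_lim (fun t => phi x t) y (phiy x y)) ->
     forall x y a b, H2 x y ->
       derivable_pt_lim (fun t => phix t y) x a ->
       derivable_pt_lim (fun t => phiy x t) y b ->
       a + b - phix x y / x = 0) ->
  exists A, 0 <= A /\ forall x y, H2bar x y -> phi x y = A * x ^ 2.
Proof.
intros [C0 [fx [fy [Dx [Dy [Cx Cy]]]]]] _ Hpos Hb Heq.
destruct Cx as [Cx [fxx [fxy [Dxx [Dxy [Cxx Cxy]]]]]].
destruct Cy as [Cy [fyx [fyy [Dyx [Dyy [Cyx Cyy]]]]]].
apply (nonnegative_axisymmetric_solution phi fx fy fxx fxy fyx fyy); [|exact Hpos].
split; [split|split|split|exact Hb|]; trivial;
  try (intros; apply is_derive_Reals; now auto).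
(* The equation is assumed for any choice of first partials; here it is taken at the continuous ones
   supplied by [Ck]. *)
intros x y Hx; apply (Heq fx fy Dx Dy); trivial.
- now apply Dxx.
- now apply Dyy.
Qed.
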